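(* Let $\mathbf{S}(1)$ be the category of all simplicial monoids with order-unit and normalized monoid homomorphisms, and let $\mathbf{wVSem}$ be the category of all weakly V-semiprimitive rings and ring homomorphisms. Then there is no functor $\Gamma\colon\mathbf{S}(1)\to\mathbf{wVSem}$ such that $\mathrm{V}\circ\Gamma\cong\mathrm{id}$ (that is, such that $\mathrm{V}\circ\Gamma$ is naturally isomorphic to the functor $(M,u)\mapsto M$, $f\mapsto f$, from $\mathbf{S}(1)$ to conical commutative monoids).
   Context: Rings are associative but not necessarily unital, and ring homomorphisms need not preserve units. Commutative monoids are written additively; a commutative monoid is conical if $x+y=0$ implies $x=y=0$, and $x\leq y$ means $y=x+z$ for some $z$ in the monoid (algebraic preordering). A simplicial monoid is a monoid isomorphic to $(\mathbb{Z}^+)^n$ for some $n\in\mathbb{Z}^+=\{0,1,2,\dots\}$. An order-unit of $M$ is an element $u\in M$ such that each $x\in M$ satisfies $x\leq nu$ for some positive integer $n$. A morphism $(M,u)\to(N,w)$ of monoids with order-unit (normalized homomorphism) is a monoid homomorphism $f\colon M\to N$ with $f(u)=w$. For a ring $R$, $\mathrm{M}_\infty(R)=\bigcup_n \mathrm{M}_n(R)$, where $\mathrm{M}_n(R)$ is embedded in $\mathrm{M}_{n+1}(R)$ by adding a zero row and a zero column; $\mathrm{I}_\infty(R)$ is the set of idempotents of $\mathrm{M}_\infty(R)$. Idempotents $a,b\in \mathrm{I}_\infty(R)$ are equivalent, $a\sim b$, if $a=xy$ and $b=yx$ for some $x,y\in \mathrm{M}_\infty(R)$; $[a]_R$ is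 the equivalence class of $a$. $\mathrm{V}(R)=\{[a]_R\mid a\in \mathrm{I}_\infty(R)\}$ is the conical commutative monoid with addition determined by $[a]_R+[b]_R=[a+b]_R$ whenever $ab=ba=0$. A ring homomorphism $f\colon R\to S$ induces $\mathrm{V}(f)\colon \mathrm{V}(R)\to \mathrm{V}(S)$, $[a]_R\mapsto[f(a)]_S$ ($f$ applied entrywise); this makes $\mathrm{V}$ a functor. Elements $\alpha,\beta$ of a conical commutative monoid $M$ are orthogonal, $\alpha\perp\beta$, if for every positive integer $n$ and every $\gamma\in M$, $\gamma\leq n\alpha$ and $\gamma\leq n\beta$ imply $\gamma=0$. $\mathrm{J}(R)$ denotes the Jacobson radical of a (not necessarily unital) ring: the largest two-sided ideal $J$ of $R$ such that for each $x\in J$ there is $s\in R$ with $x+s-sx=0$. A ring $R$ is weakly V-semiprimitive if for all $a,b\in \mathrm{I}_\infty(R)$, $[a]_R\perp[b]_R$ implies $ab\in \mathrm{J}(\mathrm{M}_\infty(R))$. *)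

(* Defs.v *)
From HB Require Import structures.
From mathcomp Require Import all_boot all_order all_algebra.
From mathcomp Require Import all_classical.

Set Implicit Arguments.
Unset Strict Implicit.
Unset Printing Implicit Defensive.

Import GRing.Theory.

Local Open Scope quotient_scope.
Local Open Scope ring_scope.

Record category := Category {
  obj :> Type;
  hom : obj -> obj -> Type;
  idm : forall X, hom X X;
  comp : forall X Y Z, hom Y Z -> hom X Y -> hom X Z;
  comp1m : forall X Y (f : hom X Y), comp (idm Y) f = f;
  compm1 : forall X Y (f : hom X Y), comp f (idm X) = f;
  compmA : forall X Y Z W (h : hom Z W) (g : hom Y Z) (f : hom X Y),
    comp h (comp g f) = comp (comp h g) f
}.
Arguments hom {_} _ _.
Arguments idm {_} X.
Arguments comp {_ _ _ _} g f.

Record functor (C D : category) := Functor {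
  fobj :> C -> D;
  fmap : forall X Y : C, hom X Y -> hom (fobj X) (fobj Y);
  fmap1 : forall X : C, fmap (idm X) = idm (fobj X);
  fmapM : forall (X Y Z : C) (g : hom Y Z) (f : hom X Y),
    fmap (comp g f) = comp (fmap g) (fmap f)
}.
Arguments fmap {C D} F {X Y} f : rename.

Section FunctorComp.
Variables (C D E : category) (G : functor D E) (F : functor C D).

Let gf_map (X Y : C) (f : hom X Y) : hom (G (F X)) (G (F Y)) :=
  fmap G (fmap F f).

Fact functor_comp_subproof1 X : gf_map (idm X) = idm (G (F X)).
Proof. by rewrite /gf_map !fmap1. Qed.

Fact functor_comp_subproofM (X Y Z : C) (g : hom Y Z) (f : hom X Y) :
  gf_map (comp g f) = comp (gf_map g) (gf_map f).
Proof. by rewrite /gf_map !fmapM. Qed.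

Definition functor_comp : functor C E :=
  Functor functor_comp_subproof1 functor_comp_subproofM.
End FunctorComp.

Definition is_iso (C : category) (X Y : C) (f : hom X Y) : Prop :=
  exists g : hom Y X, comp g f = idm X /\ comp f g = idm Y.

Definition naturally_isomorphic (C D : category) (F G : functor C D) : Prop :=
  exists eta : forall X : C, hom (F X) (G X),
    (forall X, is_iso (eta X)) /\
    (forall (X Y : C) (f : hom X Y),
       comp (fmap G f) (eta X) = comp (eta Y) (fmap F f)).

Section FullSubcategory.
Variables (C : category) (P : C -> Prop).

Record full_obj := FullObj { full_val :> C; full_prop : P full_val }.

Definition full_subcategory : category :=
  @Category full_obj (fun X Y => hom (full_val X) (full_val Y))
    (fun X => idm (full_val X)) (fun X Y Z g f => comp g f)
    (fun X Y => @comp1m C X Y) (fun X Y => @compm1 C X Y)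
    (fun X Y Z W => @compmA C X Y Z W).

Definition full_incl : functor full_subcategory C :=
  @Functor full_subcategory C full_val (fun _ _ f => f)
    (fun _ => erefl) (fun _ _ _ _ _ => erefl).
End FullSubcategory.

Definition conical (M : nmodType) : Prop :=
  forall x y : M, x + y = 0 -> x = 0 /\ y = 0.

Definition alg_le (M : nmodType) (x y : M) : Prop := exists z, y = x + z.

Definition order_unit (M : nmodType) (u : M) : Prop :=
  forall x : M, exists n : nat, (0 < n)%N /\ alg_le x (u *+ n).

Definition simplicial (M : nmodType) : Prop :=
  exists (n : nat) (f : {additive M -> {ffun 'I_n -> nat}}), bijective f.

Definition orthogonal (M : nmodType) (a b : M) : Prop :=
  forall (n : nat) (c : M), (0 < n)%N ->
    alg_le c (a *+ n) -> alg_le c (b *+ n) -> c = 0.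

Lemma simplicial_conical (M : nmodType) : simplicial M -> conical M.
Proof.
move=> [n [f bf]] x y xy0; have f_inj := bij_inj bf.
have fxy i : (f x i + f y i)%N = 0%N.
  by have /ffunP/(_ i) := raddfD f x y; rewrite xy0 raddf0 !ffunE.
by split; apply: f_inj; rewrite raddf0; apply/ffunP => i; rewrite !ffunE;
  have /eqP := fxy i; rewrite addn_eq0 => /andP[/eqP ? /eqP ?].
Qed.

Lemma additive_ext (M N : nmodType) (f g : {additive M -> N}) :
  f =1 g -> f = g.
Proof.
case: f g => [f [[fP]]] [g [[gP]]] /= /funext fg.
by subst g; rewrite (Prop_irrelevance fP gP).
Qed.

Definition cmon_id (M : nmodType) : {additive M -> M} := idfun.

Definition cmon_comp (M N P : nmodType)
    (g : {additive N -> P}) (f : {additive M -> N}) : {additive M -> P} :=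
  g \o f.

Fact cmon_comp1m (M N : nmodType) (f : {additive M -> N}) :
  cmon_comp (cmon_id N) f = f.
Proof. exact: additive_ext. Qed.

Fact cmon_compm1 (M N : nmodType) (f : {additive M -> N}) :
  cmon_comp f (cmon_id M) = f.
Proof. exact: additive_ext. Qed.

Fact cmon_compmA (M N P Q : nmodType) (h : {additive P -> Q})
    (g : {additive N -> P}) (f : {additive M -> N}) :
  cmon_comp h (cmon_comp g f) = cmon_comp (cmon_comp h g) f.
Proof. exact: additive_ext. Qed.

Definition CMon : category := Category cmon_comp1m cmon_compm1 cmon_compmA.

Definition ConCMon : category := full_subcategory (C := CMon) conical.

Record simp_unit := SimpUnit {
  su_mon :> nmodType;
  su_unit : su_mon;
  su_simplicial : simplicial su_mon;
  su_unitP : order_unit su_unit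
}.

Record simp_unit_hom (M N : simp_unit) := SimpUnitHom {
  suh_fun :> {additive M -> N};
  suh_unit : suh_fun (su_unit M) = su_unit N
}.

Lemma simp_unit_hom_ext (M N : simp_unit) (f g : simp_unit_hom M N) :
  f =1 g -> f = g.
Proof.
case: f g => [f fu] [g gu] /= /additive_ext fg.
by subst g; rewrite (Prop_irrelevance fu gu).
Qed.

Definition simp_unit_id (M : simp_unit) : simp_unit_hom M M :=
  @SimpUnitHom M M (idfun : {additive M -> M}) erefl.

Fact simp_unit_comp_subproof (M N P : simp_unit)
    (g : simp_unit_hom N P) (f : simp_unit_hom M N) :
  (g \o f : {additive M -> P}) (su_unit M) = su_unit P.
Proof. by rewrite /= !suh_unit. Qed.

Definition simp_unit_comp (M N P : simp_unit)
    (g : simp_unit_hom N P) (f : simp_unit_hom M N) : simp_unit_hom M P :=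
  SimpUnitHom (simp_unit_comp_subproof g f).

Fact simp_unit_comp1m (M N : simp_unit) (f : simp_unit_hom M N) :
  simp_unit_comp (simp_unit_id N) f = f.
Proof. exact: simp_unit_hom_ext. Qed.

Fact simp_unit_compm1 (M N : simp_unit) (f : simp_unit_hom M N) :
  simp_unit_comp f (simp_unit_id M) = f.
Proof. exact: simp_unit_hom_ext. Qed.

Fact simp_unit_compmA (M N P Q : simp_unit) (h : simp_unit_hom P Q)
    (g : simp_unit_hom N P) (f : simp_unit_hom M N) :
  simp_unit_comp h (simp_unit_comp g f) = simp_unit_comp (simp_unit_comp h g) f.
Proof. exact: simp_unit_hom_ext. Qed.

Definition S1 : category :=
  Category simp_unit_comp1m simp_unit_compm1 simp_unit_compmA.

Definition forget_unit : functor S1 ConCMon :=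
  @Functor S1 ConCMon
    (fun M => @FullObj CMon conical (su_mon M)
                (simplicial_conical (su_simplicial M)))
    (fun M N f => suh_fun f) (fun _ => erefl)
    (fun _ _ _ _ _ => additive_ext (fun=> erefl)).

(* No unit is required. As everywhere in MathComp, carriers are choiceTypes;
   classically (boolp) this is no restriction. *)
HB.mixin Record Zmodule_isRng R of GRing.Zmodule R := {
  rmul : R -> R -> R;
  rmulA : associative rmul;
  rmulDl : left_distributive rmul +%R;
  rmulDr : right_distributive rmul +%R
}.

#[short(type="rngType")]
HB.structure Definition Rng := { R of GRing.Zmodule R & Zmodule_isRng R }.

Notation "x ** y" := (rmul x y) (at level 40, left associativity) : ring_scope.

Section RngTheory.
Variable R : rngType.
Implicit Types x y z : R.

Lemma rmul0r x : 0 ** x = 0.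
Proof. by apply: (addrI (0 ** x)); rewrite -rmulDl !addr0. Qed.

Lemma rmulr0 x : x ** 0 = 0.
Proof. by apply: (addrI (x ** 0)); rewrite -rmulDr !addr0. Qed.

Lemma rmulNr x y : - x ** y = - (x ** y).
Proof. by apply/eqP; rewrite -addr_eq0 -rmulDl addNr rmul0r. Qed.

Lemma rmulrN x y : x ** - y = - (x ** y).
Proof. by apply/eqP; rewrite -addr_eq0 -rmulDr addNr rmulr0. Qed.

Lemma rmul_suml (I : Type) (r : seq I) (F : I -> R) x :
  (\sum_(i <- r) F i) ** x = \sum_(i <- r) F i ** x.
Proof.
by elim: r => [|i r IHr]; rewrite ?big_nil ?rmul0r // !big_cons rmulDl IHr.
Qed.

Lemma rmul_sumr (I : Type) (r : seq I) (F : I -> R) x :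
  x ** (\sum_(i <- r) F i) = \sum_(i <- r) x ** F i.
Proof.
by elim: r => [|i r IHr]; rewrite ?big_nil ?rmulr0 // !big_cons rmulDr IHr.
Qed.

Definition two_sided_ideal (J : set R) : Prop :=
  [/\ J 0, forall x y, J x -> J y -> J (x - y)
    & forall x y, J y -> J (x ** y) /\ J (y ** x)].

Definition quasi_regular_ideal (J : set R) : Prop :=
  two_sided_ideal J /\ forall x, J x -> exists s : R, x + s - s ** x = 0.

(* The union of all quasi-regular ideals; it is itself one, hence the
   largest one (jacobson_ideal, jacobson_max). *)
Definition jacobson : set R :=
  [set x | exists2 J : set R, quasi_regular_ideal J & J x].

Lemma jacobson_max (J : set R) :
  quasi_regular_ideal J -> (J `<=` jacobson)%classic.
Proof. by move=> JP x Jx; exists J. Qed.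

Lemma ideal_opp (J : set R) x : two_sided_ideal J -> J x -> J (- x).
Proof. by move=> [J0 JB _] Jx; rewrite -sub0r; apply: JB. Qed.

Lemma ideal_add (J : set R) x y : two_sided_ideal J -> J x -> J y -> J (x + y).
Proof.
move=> JP Jx Jy; case: (JP) => _ JB _.
by rewrite -[y]opprK; apply: JB => //; apply: ideal_opp.
Qed.

Lemma circle_assoc (t s x : R) :
  t + s - t ** s + x - (t + s - t ** s) ** x =
  t + (s + x - s ** x) - t ** (s + x - s ** x).
Proof.
rewrite !(rmulDl, rmulDr, rmulNr, rmulrN) !rmulA !opprD !opprK !addrA.
by rewrite [LHS](ACl (1*2*4*6*3*5*7)%AC).
Qed.

Lemma quasi_regular_add (I J : set R) :
  quasi_regular_ideal I -> quasi_regular_ideal J ->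
  quasi_regular_ideal [set z | exists x y, [/\ I x, J y & z = x + y]].
Proof.
move=> [IP Iq] [JP Jq]; case: (IP) => I0 IB IM; case: (JP) => J0 JB JM.
split; first split.
- by exists 0, 0; rewrite addr0.
- move=> _ _ [x [y [Ix Jy ->]]] [x' [y' [Ix' Jy' ->]]].
  exists (x - x'), (y - y'); split; [exact: IB | exact: JB |].
  by rewrite opprD addrACA.
- move=> z _ [x [y [Ix Jy ->]]]; rewrite rmulDl rmulDr.
  have [? ?] := IM z x Ix; have [? ?] := JM z y Jy.
  by split; [exists (z ** x), (z ** y) | exists (x ** z), (y ** z)].
move=> _ [x [y [Ix Jy ->]]].
have [s sP] := Iq x Ix.
have Jw : J (y - s ** y) by apply: JB => //; case: (JM s y Jy).
have [t tP] := Jq _ Jw.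
exists (t + s - t ** s).
rewrite [x + y + _]addrC circle_assoc.
suff -> : s + (x + y) - s ** (x + y) = y - s ** y by rewrite [t + _]addrC.
rewrite rmulDr opprD addrA [s + (x + y)]addrA [s + x]addrC.
by rewrite [LHS](ACl (1*3*2*4)%AC) /= sP add0r.
Qed.

Lemma jacobson_ideal : quasi_regular_ideal jacobson.
Proof.
split; last by move=> x [J [_ Jq] /Jq].
split.
- exists [set 0]%classic => //; split; first split=> //.
  + by move=> x y -> ->; rewrite subr0.
  + by move=> x y ->; rewrite rmulr0 rmul0r.
  + by move=> x ->; exists 0; rewrite rmul0r subr0 addr0.
- move=> x y [I IP Ix] [J JP Jy].
  exists [set z | exists x y, [/\ I x, J y & z = x + y]]%classic.
    exact: quasi_regular_add.
  by exists x, (- y); split=> //; apply: ideal_opp => //; case: JP.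
- move=> x y [J JP Jy]; have [[_ _ JM] _] := JP.
  by have [? ?] := JM x y Jy; split; exists J.
Qed.

End RngTheory.

Record rng_hom (R S : rngType) := RngHom {
  rh_fun :> {additive R -> S};
  rh_mul : {morph rh_fun : x y / x ** y}
}.

Lemma rng_hom_ext (R S : rngType) (f g : rng_hom R S) : f =1 g -> f = g.
Proof.
case: f g => [f fM] [g gM] /= /additive_ext fg.
by subst g; rewrite (Prop_irrelevance fM gM).
Qed.

Definition rng_id (R : rngType) : rng_hom R R :=
  @RngHom R R (idfun : {additive R -> R}) (fun _ _ => erefl).

Fact rng_comp_subproof (R S T : rngType) (g : rng_hom S T) (f : rng_hom R S) :
  {morph (g \o f : {additive R -> T}) : x y / x ** y}.
Proof. by move=> x y /=; rewrite !rh_mul. Qed.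

Definition rng_comp (R S T : rngType) (g : rng_hom S T) (f : rng_hom R S) :
  rng_hom R T := RngHom (rng_comp_subproof g f).

Fact rng_comp1m (R S : rngType) (f : rng_hom R S) : rng_comp (rng_id S) f = f.
Proof. exact: rng_hom_ext. Qed.

Fact rng_compm1 (R S : rngType) (f : rng_hom R S) : rng_comp f (rng_id R) = f.
Proof. exact: rng_hom_ext. Qed.

Fact rng_compmA (R S T U : rngType) (h : rng_hom T U) (g : rng_hom S T)
    (f : rng_hom R S) : rng_comp h (rng_comp g f) = rng_comp (rng_comp h g) f.
Proof. exact: rng_hom_ext. Qed.

Definition RngCat : category := Category rng_comp1m rng_compm1 rng_compmA.

(* The image of 'M[R]_n in the union of all the 'M[R]_m: an N x N array
   vanishing outside of its upper left n x n corner. *)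
Definition in_mx (R : rngType) (n : nat) (A : nat -> nat -> R) : Prop :=
  forall i j, (n <= i)%N || (n <= j)%N -> A i j = 0.

Record infmx (R : rngType) := InfMx {
  im_fun :> nat -> nat -> R;
  im_fin : exists n, in_mx n im_fun
}.

Section InfMx.
Variable R : rngType.
Implicit Types A B C : infmx R.

HB.instance Definition _ := gen_eqMixin (infmx R).
HB.instance Definition _ := gen_choiceMixin (infmx R).

Lemma infmxP A B : (forall i j, A i j = B i j) <-> A = B.
Proof.
split=> [|-> //]; case: A B => [A Af] [B Bf] /= AB.
have AB' : A = B by apply/funext => i; apply/funext => j.
by subst B; rewrite (Prop_irrelevance Af Bf).
Qed.

Lemma in_mxW m n (A : nat -> nat -> R) : (m <= n)%N -> in_mx m A -> in_mx n A.
Proof.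
by move=> mn Am i j /orP[] h; apply: Am; rewrite (leq_trans mn h) ?orbT.
Qed.

Lemma im_fin2 A B : exists n, in_mx n A /\ in_mx n B.
Proof.
have [[m Am] [n Bn]] := (im_fin A, im_fin B); exists (maxn m n).
by split; [apply: in_mxW Am | apply: in_mxW Bn]; rewrite (leq_maxl, leq_maxr).
Qed.

Fact im_zero_fin : exists n, in_mx n (fun _ _ => 0 : R).
Proof. by exists 0%N. Qed.
Definition im_zero := InfMx im_zero_fin.

Fact im_opp_fin A : exists n, in_mx n (fun i j => - A i j).
Proof. by have [n An] := im_fin A; exists n => i j /An ->; rewrite oppr0. Qed.
Definition im_opp A := InfMx (im_opp_fin A).

Fact im_add_fin A B : exists n, in_mx n (fun i j => A i j + B i j).
Proof.
have [n [An Bn]] := im_fin2 A B.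
by exists n => i j ij; rewrite An // Bn // addr0.
Qed.
Definition im_add A B := InfMx (im_add_fin A B).

Fact im_addA : associative im_add.
Proof. by move=> A B C; apply/infmxP => i j; apply: addrA. Qed.
Fact im_addC : commutative im_add.
Proof. by move=> A B; apply/infmxP => i j; apply: addrC. Qed.
Fact im_add0 : left_id im_zero im_add.
Proof. by move=> A; apply/infmxP => i j; apply: add0r. Qed.
Fact im_addN : left_inverse im_zero im_opp im_add.
Proof. by move=> A; apply/infmxP => i j; apply: addNr. Qed.

HB.instance Definition _ :=
  GRing.isZmodule.Build (infmx R) im_addA im_addC im_add0 im_addN.

(* All but finitely many terms of the sum vanish. *)
Definition im_mul_fun A B (i j : nat) : R :=
  \sum_(k \in [set: nat]) A i k ** B k j.

Lemma im_mul_funE n A B i j : in_mx n A \/ in_mx n B ->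
  im_mul_fun A B i j = \sum_(k < n) A i k ** B k j.
Proof.
move=> AB; rewrite (fsbig_ord _ n (fun k => A i k ** B k j)).
symmetry; apply: fsbig_widen => // k [_ /= /negP]; rewrite -leqNgt => nk.
by case: AB => [->|->]; rewrite ?nk ?orbT ?rmul0r ?rmulr0.
Qed.

Fact im_mul_fin A B : exists n, in_mx n (im_mul_fun A B).
Proof.
have [n [An Bn]] := im_fin2 A B; exists n => i j ij.
rewrite (im_mul_funE _ _ (or_introl An)) big1 // => k _.
by case/orP: ij => h; [rewrite An ?h ?rmul0r | rewrite Bn ?h ?orbT ?rmulr0].
Qed.
Definition im_mul A B := InfMx (im_mul_fin A B).

Lemma im_mulE n A B i j : in_mx n A \/ in_mx n B ->
  im_mul A B i j = \sum_(k < n) A i k ** B k j.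
Proof. exact: im_mul_funE. Qed.

Fact im_mulA : associative im_mul.
Proof.
move=> A B C; apply/infmxP => i j.
have [[m Am] [n Cn]] := (im_fin A, im_fin C).
rewrite (im_mulE _ _ (or_introl Am)) (im_mulE _ _ (or_intror Cn)).
under eq_bigr do rewrite (im_mulE _ _ (or_intror Cn)) rmul_sumr.
under [RHS]eq_bigr do rewrite (im_mulE _ _ (or_introl Am)) rmul_suml.
rewrite exchange_big /=.
by apply: eq_bigr => l _; apply: eq_bigr => k _; rewrite rmulA.
Qed.

Fact im_mulDl : left_distributive im_mul +%R.
Proof.
move=> A B C; apply/infmxP => i j; have [n Cn] := im_fin C.
transitivity (im_mul A C i j + im_mul B C i j) => //.
rewrite !(im_mulE _ _ (or_intror Cn)) -big_split.
by apply: eq_bigr => k _; apply: rmulDl.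
Qed.

Fact im_mulDr : right_distributive im_mul +%R.
Proof.
move=> A B C; apply/infmxP => i j; have [n An] := im_fin A.
transitivity (im_mul A B i j + im_mul A C i j) => //.
rewrite !(im_mulE _ _ (or_introl An)) -big_split.
by apply: eq_bigr => k _; apply: rmulDr.
Qed.

HB.instance Definition _ :=
  Zmodule_isRng.Build (infmx R) im_mulA im_mulDl im_mulDr.

Lemma infmx_mulE n A B i j : in_mx n A \/ in_mx n B ->
  (A ** B) i j = \sum_(k < n) A i k ** B k j.
Proof. exact: im_mulE. Qed.

(* Row and column reindexing of infinite matrices along k |-> k, k.*2 and
   k.*2.+1: half_ix o is the partial inverse of that map. *)
Definition half_ix (o : option bool) (k : nat) : option nat :=
  if o is Some b then if odd k == b then Some k./2 else None else Some k.

Definition spread_fun (o p : option bool) A (k l : nat) : R :=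
  if half_ix o k is Some i then if half_ix p l is Some j then A i j else 0
  else 0.

Lemma half_ix_ge n o k i : (n.*2 <= k)%N -> half_ix o k = Some i -> (n <= i)%N.
Proof.
case: o => [b|] /= nk; last by case=> <-; rewrite (leq_trans _ nk) // -addnn leq_addr.
by case: eqP => // _ [<-]; rewrite geq_half_double.
Qed.

Lemma in_mx_spread n o p A : in_mx n A -> in_mx n.*2 (spread_fun o p A).
Proof.
move=> An i j ij; rewrite /spread_fun.
case Ei: (half_ix o i) => [i'|] //; case Ej: (half_ix p j) => [j'|] //.
apply: An; case/orP: ij => h; first by rewrite (half_ix_ge h Ei).
by rewrite (half_ix_ge h Ej) orbT.
Qed.

Fact spread_fin o p A : exists n, in_mx n (spread_fun o p A).
Proof. by have [n An] := im_fin A; exists n.*2; apply: in_mx_spread. Qed.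
Definition spread o p A := InfMx (spread_fin o p A).

Lemma sum_double n (F : nat -> R) :
  \sum_(k < n.*2) F k = \sum_(k < n) (F k.*2 + F k.*2.+1).
Proof.
elim: n => [|n IHn]; first by rewrite !big_ord0.
by rewrite doubleS !big_ord_recr /= IHn addrA.
Qed.

Lemma spread_mul o p q A B :
  spread o p A ** spread p q B = spread o q (A ** B).
Proof.
apply/infmxP => i j; have [n An] := im_fin A.
rewrite (@infmx_mulE n.*2); last by left; apply: in_mx_spread.
rewrite /= /spread_fun; case: (half_ix o i) => [i'|]; last first.
  by rewrite big1 // => k _; rewrite rmul0r.
case: (half_ix q j) => [j'|]; last first.
  by rewrite big1 // => k _; case: (half_ix p k) => [k'|]; rewrite rmulr0.
case: p => [b|] /=; last first.
  by rewrite -infmx_mulE //; left; apply: in_mxW An; rewrite -addnn leq_addr.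
pose F k := (if (if odd k == b then Some k./2 else None) is Some k' then
    A i' k' else 0) ** (if (if odd k == b then Some k./2 else None) is Some k'
    then B k' j' else 0).
rewrite -[LHS]/(\sum_(k < n.*2) F k) sum_double.
rewrite -[RHS]/((A ** B) i' j') (infmx_mulE _ _ (or_introl An)).
apply: eq_bigr => k _; rewrite {}/F /= !odd_double doubleK uphalf_double.
by case: b; rewrite /= ?rmul0r ?(add0r, addr0).
Qed.

Lemma spread_mul0 o b q A B :
  spread o (Some b) A ** spread (Some (~~ b)) q B = 0.
Proof.
apply/infmxP => i j; have [n An] := im_fin A.
rewrite (@infmx_mulE n.*2); last by left; apply: in_mx_spread.
rewrite big1 // => k _; rewrite /= /spread_fun /=.
by case: (odd k) b => [] []; case: (half_ix o i) => [i'|]; rewrite ?rmul0r ?rmulr0.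
Qed.

Lemma spreadD o p A B : spread o p (A + B) = spread o p A + spread o p B.
Proof.
apply/infmxP => i j.
transitivity (spread o p A i j + spread o p B i j) => //.
rewrite /= /spread_fun; case: (half_ix o i) => [i'|]; rewrite ?addr0 //.
by case: (half_ix p j) => [j'|]; rewrite ?addr0.
Qed.

Lemma spread0 o p : spread o p 0 = 0.
Proof. by apply: (addrI (spread o p 0)); rewrite -spreadD !addr0. Qed.

Lemma spreadNN A : spread None None A = A.
Proof. exact/infmxP. Qed.

End InfMx.

Record idem (R : rngType) := Idem {
  imx :> infmx R;
  idemP : imx ** imx = imx
}.

Definition idem_equiv (R : rngType) (a b : idem R) : Prop :=
  exists x y : infmx R, imx a = x ** y /\ imx b = y ** x.

Section VMonoid.
Variable R : rngType.
Implicit Types a b c d : idem R.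

HB.instance Definition _ := gen_eqMixin (idem R).
HB.instance Definition _ := gen_choiceMixin (idem R).

Lemma idem_inj a b : imx a = imx b -> a = b.
Proof.
case: a b => [a aP] [b bP] /= ab.
by subst b; rewrite (Prop_irrelevance aP bP).
Qed.

Lemma idem_equiv_refl a : idem_equiv a a.
Proof. by exists (imx a), (imx a); rewrite idemP. Qed.

Lemma idem_equiv_sym a b : idem_equiv a b -> idem_equiv b a.
Proof. by move=> [x [y [? ?]]]; exists y, x. Qed.

Lemma idem_equiv_trans b a c :
  idem_equiv a b -> idem_equiv b c -> idem_equiv a c.
Proof.
move=> [x [y [aE bE]]] [z [t [bE' cE]]]; exists (x ** z), (t ** y); split.
  by rewrite -!rmulA [z ** _]rmulA -bE' bE !rmulA -aE -rmulA -aE idemP.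
by rewrite -!rmulA [y ** _]rmulA -bE bE' !rmulA -cE -rmulA -cE idemP.
Qed.

Lemma idem_equiv_corner a b : idem_equiv a b ->
  exists x y : infmx R,
    [/\ imx a = x ** y, imx b = y ** x,
        imx a ** x = x, x ** imx b = x & imx b ** y = y /\ y ** imx a = y].
Proof.
move=> [x [y [aE bE]]]; exists (imx a ** x), (y ** imx a).
have aa := idemP a; have bb := idemP b.
have xyx : x ** imx b = imx a ** x by rewrite bE aE rmulA.
have yxy : imx b ** y = y ** imx a by rewrite bE aE rmulA.
split; last split.
- by rewrite rmulA -[imx a ** x ** y]rmulA -aE !aa.
- by rewrite rmulA -[y ** imx a ** imx a]rmulA aa -rmulA -xyx rmulA -bE bb.
- by rewrite rmulA aa.
- by rewrite -rmulA xyx rmulA aa.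
- by rewrite rmulA yxy -rmulA aa.
- by rewrite -rmulA aa.
Qed.

Definition idem_equivb : rel (idem R) := fun a b => `[< idem_equiv a b >].

Fact idem_equivb_equiv : equiv_class_of idem_equivb.
Proof.
split=> [a|a b|b a c]; rewrite /idem_equivb.
- exact/asboolP/idem_equiv_refl.
- by apply/asboolP/asboolP; apply: idem_equiv_sym.
- by move=> /asboolP ab /asboolP bc; apply/asboolP/(idem_equiv_trans ab).
Qed.

Canonical idem_equiv_equiv := EquivRelPack idem_equivb_equiv.

Definition V := {eq_quot idem_equivb}.
HB.instance Definition _ := Choice.on V.
HB.instance Definition _ := EqQuotient.on V.

Definition V_class a : V := \pi_V a.

Lemma V_classP a b : V_class a = V_class b <-> idem_equiv a b.
Proof. by split=> [/eqmodP /asboolP | ab]; last exact/eqmodP/asboolP. Qed.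

Lemma V_ind (P : V -> Prop) : (forall a, P (V_class a)) -> forall p, P p.
Proof. by move=> Pc p; rewrite -[p]reprK; apply: Pc. Qed.

Lemma V_reprP a : idem_equiv (repr (V_class a)) a.
Proof. by apply/V_classP; rewrite /V_class reprK. Qed.

Definition idem_orth a b : Prop := imx a ** imx b = 0 /\ imx b ** imx a = 0.

Fact idem_orth_add_subproof a b : idem_orth a b ->
  (imx a + imx b) ** (imx a + imx b) =
  imx a + imx b.
Proof.
by move=> [ab ba]; rewrite rmulDl !rmulDr !idemP ab ba addr0 add0r.
Qed.

Definition idem_orth_add a b (ab : idem_orth a b) : idem R :=
  Idem (idem_orth_add_subproof ab).

Lemma idem_orth_add_equiv a a' b b'
    (ab : idem_orth a b) (ab' : idem_orth a' b') :
  idem_equiv a a' -> idem_equiv b b' ->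
  idem_equiv (idem_orth_add ab) (idem_orth_add ab').
Proof.
move=> /idem_equiv_corner[x [y [aE aE' ax xa [ya ay]]]].
move=> /idem_equiv_corner[z [t [bE bE' bz zb [tb bt]]]].
have [ab0 ba0] := ab; have [ab0' ba0'] := ab'.
exists (x + z), (y + t) => /=; rewrite !rmulDl !rmulDr.
have -> : x ** t = 0 by rewrite -xa -tb -rmulA [imx a' ** _]rmulA ab0' rmul0r rmulr0.
have -> : z ** y = 0 by rewrite -zb -ya -rmulA [imx b' ** _]rmulA ba0' rmul0r rmulr0.
have -> : y ** z = 0 by rewrite -ay -bz -rmulA [imx a ** _]rmulA ab0 rmul0r rmulr0.
have -> : t ** x = 0 by rewrite -bt -ax -rmulA [imx b ** _]rmulA ba0 rmul0r rmulr0.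
by rewrite !addr0 !add0r -aE -bE -aE' -bE'.
Qed.

(* The copy of a supported on the even (p = false) or odd (p = true) indices. *)
Fact idem_copy_subproof (p : bool) a :
  spread (Some p) (Some p) a ** spread (Some p) (Some p) a =
  spread (Some p) (Some p) a.
Proof. by rewrite spread_mul idemP. Qed.
Definition idem_copy p a : idem R := Idem (idem_copy_subproof p a).

Lemma idem_copy_equiv p a : idem_equiv (idem_copy p a) a.
Proof.
exists (spread (Some p) None a), (spread None (Some p) a) => /=.
by rewrite !spread_mul spreadNN idemP.
Qed.

Lemma idem_copy_orth a b : idem_orth (idem_copy false a) (idem_copy true b).
Proof. by split; rewrite /= spread_mul0. Qed.

Lemma idem_copy_orthW p a b :
  idem_orth a b -> idem_orth (idem_copy p a) (idem_copy p b).
Proof. by case=> ab ba; split; rewrite /= spread_mul (ab, ba) spread0. Qed.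

Definition idem_sum a b : idem R := idem_orth_add (idem_copy_orth a b).

Fact idem_zero_subproof : (0 : infmx R) ** 0 = 0.
Proof. exact: rmul0r. Qed.
Definition idem_zero : idem R := Idem idem_zero_subproof.

Definition V_zero : V := V_class idem_zero.
(* Adds copies of the representatives placed on the even and on the odd
   indices; by V_classD, [a] + [b] = [a + b] for any orthogonal a and b. *)
Definition V_add (p q : V) : V := V_class (idem_sum (repr p) (repr q)).

Fact V_add_orth a b (ab : idem_orth a b) :
  V_add (V_class a) (V_class b) = V_class (idem_orth_add ab).
Proof.
apply/V_classP/idem_orth_add_equiv;
  by apply: idem_equiv_trans (V_reprP _); apply: idem_copy_equiv.
Qed.

Lemma V_class_copy p a : V_class (idem_copy p a) = V_class a.
Proof. exact/V_classP/idem_copy_equiv. Qed.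

Lemma V_class_inj a b : imx a = imx b -> V_class a = V_class b.
Proof. by move=> /idem_inj ->. Qed.

Fact V_addC : commutative V_add.
Proof.
elim/V_ind=> a; elim/V_ind=> b.
have orth := idem_copy_orth a b; have orth' : idem_orth (idem_copy true b)
  (idem_copy false a) by case: orth.
rewrite -(V_class_copy false a) -(V_class_copy true b).
by rewrite (V_add_orth orth) (V_add_orth orth'); apply/V_class_inj/addrC.
Qed.

Fact V_add0 : left_id V_zero V_add.
Proof.
elim/V_ind=> a; have orth : idem_orth idem_zero a.
  by split; rewrite ?rmul0r ?rmulr0.
by rewrite (V_add_orth orth); apply/V_class_inj/add0r.
Qed.

Fact V_addA : associative V_add.
Proof.
elim/V_ind=> a; elim/V_ind=> b; elim/V_ind=> c.
pose a' := idem_copy false (idem_copy false a).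
pose b' := idem_copy false (idem_copy true b).
pose c' := idem_copy true c.
have ab : idem_orth a' b' by apply/idem_copy_orthW/idem_copy_orth.
have ac : idem_orth a' c' by apply: idem_copy_orth.
have bc : idem_orth b' c' by apply: idem_copy_orth.
have abc : idem_orth (idem_orth_add ab) c'.
  case: ac bc => [ac1 ac2] [bc1 bc2].
  by split; rewrite /= (rmulDl, rmulDr) (ac1, ac2) (bc1, bc2) addr0.
have abc' : idem_orth a' (idem_orth_add bc).
  case: ab ac {abc} => [ab1 ab2] [ac1 ac2].
  by split; rewrite /= (rmulDl, rmulDr) (ac1, ac2) (ab1, ab2) addr0.
have -> : V_class a = V_class a' by rewrite !V_class_copy.
have -> : V_class b = V_class b' by rewrite !V_class_copy.
have -> : V_class c = V_class c' by rewrite V_class_copy.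
rewrite (V_add_orth ab) (V_add_orth bc) (V_add_orth abc) (V_add_orth abc').
by apply/V_class_inj; apply: addrA.
Qed.

HB.instance Definition _ :=
  GRing.isNmodule.Build V V_addA V_addC V_add0.

Lemma V_classD a b (ab : idem_orth a b) :
  V_class a + V_class b = V_class (idem_orth_add ab).
Proof. exact: V_add_orth. Qed.

Lemma V_class_eq0 a : V_class a = 0 -> imx a = 0.
Proof.
move=> /V_classP[x [y [aE yx]]].
by rewrite -idemP aE -rmulA [y ** _]rmulA -yx /= rmul0r rmulr0.
Qed.

Lemma V_conical : conical V.
Proof.
move=> p q; elim/V_ind: p => a; elim/V_ind: q => b.
have orth := idem_copy_orth a b.
rewrite -(V_class_copy false a) -(V_class_copy true b) (V_classD orth).
move: orth; set a' := idem_copy _ a; set b' := idem_copy _ b => orth.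
move=> /V_class_eq0 /= ab0; have [ab ba] := orth.
have aE : imx a' = imx a' ** (imx a' + imx b').
  by rewrite rmulDr idemP ab addr0.
have bE : imx b' = imx b' ** (imx a' + imx b').
  by rewrite rmulDr idemP ba add0r.
by split; apply/V_class_inj; rewrite (aE, bE) ab0 rmulr0.
Qed.

End VMonoid.

Section VMap.
Variables (R S : rngType) (f : rng_hom R S).

Fact map_infmx_fin (A : infmx R) : exists n, in_mx n (fun i j => f (A i j)).
Proof. by have [n An] := im_fin A; exists n => i j /An ->; rewrite raddf0. Qed.
Definition map_infmx A : infmx S := InfMx (map_infmx_fin A).

Lemma map_infmxM A B : map_infmx (A ** B) = map_infmx A ** map_infmx B.
Proof.
apply/infmxP => i j; have [n An] := im_fin A.
rewrite (@infmx_mulE _ n); last by left=> k l /An /= ->; rewrite raddf0.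
rewrite /= -[im_mul_fun A B i j]/((A ** B) i j).
rewrite (infmx_mulE _ _ (or_introl An)) raddf_sum.
by apply: eq_bigr => k _; rewrite rh_mul.
Qed.

Lemma map_infmxD A B : map_infmx (A + B) = map_infmx A + map_infmx B.
Proof. by apply/infmxP => i j; apply: raddfD. Qed.

Lemma map_infmx0 : map_infmx 0 = 0.
Proof. by apply/infmxP => i j; apply: raddf0. Qed.

Fact map_idem_subproof (a : idem R) :
  map_infmx a ** map_infmx a = map_infmx a.
Proof. by rewrite -map_infmxM idemP. Qed.
Definition map_idem a : idem S := Idem (map_idem_subproof a).

(* [a] |-> [f(a)], see V_map_class. *)
Definition V_map (p : V R) : V S := V_class (map_idem (repr p)).

Lemma V_map_class a : V_map (V_class a) = V_class (map_idem a).
Proof.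
have [x [y [xy yx]]] := V_reprP a; apply/V_classP.
by exists (map_infmx x), (map_infmx y); rewrite -!map_infmxM /= xy yx.
Qed.

Fact V_map_additive : nmod_morphism V_map.
Proof.
split=> [|p q].
  by rewrite -[0]/(V_class (idem_zero R)) V_map_class; apply/V_class_inj/map_infmx0.
elim/V_ind: p => a; elim/V_ind: q => b.
have orth := idem_copy_orth a b.
rewrite -(V_class_copy false a) -(V_class_copy true b) (V_classD orth).
have orth' : idem_orth (map_idem (idem_copy false a))
                       (map_idem (idem_copy true b)).
  case: orth => ab ba.
  by split; rewrite /= -map_infmxM (ab, ba) map_infmx0.
by rewrite !V_map_class (V_classD orth'); apply/V_class_inj/map_infmxD.
Qed.

HB.instance Definition _ :=
  GRing.isNmodMorphism.Build (V R) (V S) V_map V_map_additive.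

End VMap.

Fact V_map_id (R : rngType) :
  (V_map (rng_id R) : {additive V R -> V R}) = cmon_id (V R).
Proof.
apply: additive_ext; elim/V_ind => a.
by rewrite /= V_map_class; apply/V_class_inj/infmxP.
Qed.

Fact V_map_comp (R S T : rngType) (g : rng_hom S T) (f : rng_hom R S) :
  (V_map (rng_comp g f) : {additive V R -> V T}) =
  cmon_comp (V_map g) (V_map f).
Proof.
apply: additive_ext; elim/V_ind => a.
by rewrite /= !V_map_class; apply/V_class_inj/infmxP.
Qed.

Definition V_functor : functor RngCat ConCMon :=
  @Functor RngCat ConCMon
    (fun R : rngType => @FullObj CMon conical (V R : nmodType) (@V_conical R))
    (fun R S f => V_map f : {additive V R -> V S}) V_map_id
    (fun R S T g f => V_map_comp g f).

Definition weakly_V_semiprimitive (R : rngType) : Prop :=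
  forall a b : idem R, orthogonal (V_class a) (V_class b) ->
    jacobson (imx a ** imx b).

Definition wVSem : category :=
  full_subcategory (C := RngCat) weakly_V_semiprimitive.

Definition V_wVSem : functor wVSem ConCMon :=
  functor_comp V_functor (full_incl (C := RngCat) weakly_V_semiprimitive).

(* Main.v *)
(* Let s be the swap on (Z^+)^2 and h : ((Z^+)^2, (1,1)) -> (Z^+, 2) the sum, so
   that h o s = h. Let a be an idempotent lifting (1,0), and put b = Gamma(s)(a)
   and c = Gamma(h)(a) = Gamma(h)(b). The classes (1,0) and (0,1) of a and b are
   orthogonal, so ab lies in the Jacobson radical, while Gamma(h)(ab) = c c = c.
   Applying Gamma(h) to the quasi-inverse t of ab gives c + t' = t' c, whence
   c = 0 after multiplying by c on the right; but c has class h(1,0) = 1. *)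
From HB Require Import structures.
From mathcomp Require Import all_boot all_order all_algebra.
From mathcomp Require Import all_classical.
Require Import Defs.

Set Implicit Arguments.
Unset Strict Implicit.
Unset Printing Implicit Defensive.

Import GRing.Theory.

Local Open Scope ring_scope.

Lemma left_quasi_regular_idem (R : rngType) (c t : R) :
  c ** c = c -> c + t - t ** c = 0 -> c = 0.
Proof.
move=> cc /(congr1 (fun x => x ** c)).
by rewrite !rmulDl rmulNr -rmulA cc rmul0r addrK.
Qed.

(** Since [f] need not be surjective, [C] need not lie in the radical over [S]; only the
    quasi-inverse equation of [A] is transported. *)
Lemma map_infmx_jacobson_idem (R S : rngType) (f : rng_hom R S)
    (A : infmx R) (C := map_infmx f A) :
  jacobson A -> C ** C = C -> C = 0.
Proof.
move=> JA CC; have [_ /(_ A JA)[T AT]] := jacobson_ideal (infmx R).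
apply: (left_quasi_regular_idem (t := map_infmx f T)) => //.
(* The equation is put in subtraction-free form, so that additivity and multiplicativity of
   [map_infmx] suffice. *)
have CTE : C + map_infmx f T = map_infmx f T ** C.
  by rewrite -map_infmxM -map_infmxD; congr map_infmx; apply/eqP; rewrite -subr_eq0 AT.
by rewrite CTE subrr.
Qed.

Lemma V_map_orthogonal_eq0 (R S : rngType) (f : rng_hom R S) (a b : idem R) :
  weakly_V_semiprimitive R -> orthogonal (V_class a) (V_class b) ->
  map_infmx f a = map_infmx f b -> V_map f (V_class a) = 0.
Proof.
move=> Rss /Rss Jab fab; rewrite V_map_class; apply: V_class_inj => /=.
have fabE : map_infmx f (imx a ** imx b) = map_infmx f a.
  by rewrite map_infmxM -fab -map_infmxM idemP.
rewrite -fabE; apply: map_infmx_jacobson_idem => //.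
by rewrite fabE -map_infmxM idemP.
Qed.

(** Additive maps preserve the algebraic preorder, so a common lower bound [c] maps to a common
    lower bound [f c], which vanishes. This pulls orthogonality back along the natural
    isomorphism. *)
Lemma orthogonal_inj (M N : nmodType) (f : {additive M -> N}) (a b : M) :
  injective f -> orthogonal (f a) (f b) -> orthogonal a b.
Proof.
move=> f_inj fab n c n_gt0 [x ax] [y yb]; apply: f_inj; rewrite raddf0.
by apply: (fab n) => //; [exists (f x) | exists (f y)];
  rewrite -raddfMn (ax, yb) raddfD.
Qed.

Lemma is_iso_inj (X Y : ConCMon) (f : hom X Y) :
  is_iso f -> injective (f : {additive full_val X -> full_val Y}).
Proof.
case=> g [gf _] x y fxy.
have gfK z : (g : {additive _ -> _}) ((f : {additive _ -> _}) z) = z.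
  by rewrite -[RHS]/((idm X : {additive _ -> _}) z) -gf.
by rewrite -[x]gfK fxy gfK.
Qed.

Lemma is_iso_surj (X Y : ConCMon) (f : hom X Y) : is_iso f ->
  forall y, exists x, (f : {additive full_val X -> full_val Y}) x = y.
Proof.
case=> g [_ fg] y; exists ((g : {additive _ -> _}) y).
by rewrite -[RHS]/((idm Y : {additive _ -> _}) y) -fg.
Qed.

Section SwapAndSum.

Let Nn n := {ffun 'I_n -> nat}.

Lemma ffun_nat_natmul n (x : Nn n) k i : (x *+ k) i = (x i * k)%N.
Proof.
elim: k => [|k IHk]; first by rewrite mulr0n ffunE muln0.
by rewrite mulrS ffunE IHk mulnS.
Qed.

Lemma ffun_nat_simplicial n : simplicial (Nn n).
Proof. by exists n, idfun; exists id. Qed.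

Lemma ffun_nat_order_unit n (u : Nn n) :
  (forall i, (0 < u i)%N) -> order_unit u.
Proof.
(* One multiple serves all coordinates: each [x i] is at most the total, and [u i] is at least 1.
   The successor keeps the multiple positive when [x] is 0, and the truncated subtraction below is
   exact. *)
move=> u_gt0 x; exists (\sum_i x i).+1; split=> //.
exists [ffun i => u i * (\sum_i x i).+1 - x i]%N; apply/ffunP => i.
rewrite ffun_nat_natmul !ffunE [RHS]subnKC // (bigD1 i) //=.
by rewrite -[leqLHS]mul1n leq_mul // -addnS leq_addr.
Qed.

Fact ones2_gt0 (i : 'I_2) : (0 < [ffun=> 1%N] i)%N.
Proof. by rewrite ffunE. Qed.

Fact two1_gt0 (i : 'I_1) : (0 < [ffun=> 2%N] i)%N.
Proof. by rewrite ffunE. Qed.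

Definition NN_11 : S1 :=
  SimpUnit (ffun_nat_simplicial 2) (ffun_nat_order_unit ones2_gt0).

Definition N_2 : S1 :=
  SimpUnit (ffun_nat_simplicial 1) (ffun_nat_order_unit two1_gt0).

Definition swap_fun (x : Nn 2) : Nn 2 := [ffun i => x (rev_ord i)].

Fact swap_fun_additive : nmod_morphism swap_fun.
Proof. by split=> [|x y]; apply/ffunP => i; rewrite !ffunE. Qed.

HB.instance Definition _ :=
  GRing.isNmodMorphism.Build (Nn 2) (Nn 2) swap_fun swap_fun_additive.

Definition sum_fun (x : Nn 2) : Nn 1 := [ffun=> \sum_i x i].

Fact sum_fun_additive : nmod_morphism sum_fun.
Proof.
split=> [|x y]; apply/ffunP => i; rewrite !ffunE.
  by rewrite big1 // => j _; rewrite ffunE.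
by rewrite -big_split; apply: eq_bigr => j _; rewrite ffunE.
Qed.

HB.instance Definition _ :=
  GRing.isNmodMorphism.Build (Nn 2) (Nn 1) sum_fun sum_fun_additive.

Fact swap_unit : swap_fun (su_unit NN_11) = su_unit NN_11.
Proof. by apply/ffunP => i; rewrite !ffunE. Qed.

Fact sum_unit : sum_fun (su_unit NN_11) = su_unit N_2.
Proof. by apply/ffunP => i; rewrite !ffunE !big_ord_recl big_ord0 !ffunE. Qed.

Definition swap : @hom S1 NN_11 NN_11 :=
  @SimpUnitHom NN_11 NN_11 swap_fun swap_unit.

Definition sum : @hom S1 NN_11 N_2 := @SimpUnitHom NN_11 N_2 sum_fun sum_unit.

Lemma sum_swap : comp sum swap = sum.
Proof.
apply: simp_unit_hom_ext => x; apply/ffunP => i; rewrite !ffunE.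
by rewrite [RHS](reindex_inj rev_ord_inj); apply: eq_bigr => j _; rewrite ffunE.
Qed.

Definition e0 : Nn 2 := [ffun i => (i == ord0) : nat].

Lemma ffun_nat_le_eq0 n (x c : Nn n) k i :
  alg_le c (x *+ k) -> x i = 0%N -> c i = 0%N.
Proof.
move=> [z /ffunP/(_ i)] + xi0; rewrite ffun_nat_natmul xi0 mul0n !ffunE natrDE.
by move/esym/eqP; rewrite addn_eq0 => /andP[/eqP].
Qed.

Lemma e0_swap_orthogonal : orthogonal e0 (swap_fun e0).
Proof.
move=> n c _ /ffun_nat_le_eq0 c_e0 /ffun_nat_le_eq0 c_e1.
apply/ffunP => i; rewrite [RHS]ffunE.
(* The supports are disjoint: index 0 is killed by the swapped vector, index 1 by [e0]. *)
by case: i => -[|[|//]] ?; [apply: c_e1 | apply: c_e0]; rewrite !ffunE.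
Qed.

Lemma sum_e0_neq0 : sum_fun e0 <> 0.
Proof.
by move=> /ffunP/(_ ord0); rewrite !ffunE !big_ord_recl big_ord0 !ffunE.
Qed.

End SwapAndSum.

Theorem corollary6p6 :
  ~ exists Gamma : functor S1 wVSem,
      naturally_isomorphic (functor_comp V_wVSem Gamma) forget_unit.
Proof.
move=> [Gamma [eta [eta_iso eta_nat]]].
pose R : rngType := full_val (Gamma NN_11).
pose S : rngType := full_val (Gamma N_2).
pose s : rng_hom R R := fmap Gamma swap.
pose h : rng_hom R S := fmap Gamma sum.
pose etaR : {additive V R -> su_mon NN_11} := eta NN_11.
pose etaS : {additive V S -> su_mon N_2} := eta N_2.
have etaR_inj : injective etaR := is_iso_inj (eta_iso NN_11).
(* The naturality squares of [swap] and [sum], evaluated at a point. *)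
have eta_s p : swap_fun (etaR p) = etaR (V_map s p).
  exact: (congr1 (fun k : {additive V R -> su_mon NN_11} => k p)
    (eta_nat _ _ swap)).
have eta_h p : sum_fun (etaR p) = etaS (V_map h p).
  exact: (congr1 (fun k : {additive V R -> su_mon N_2} => k p)
    (eta_nat _ _ sum)).
have hs : rng_comp h s = h.
  by rewrite -[LHS](fmapM Gamma sum swap) sum_swap.
have [p] := is_iso_surj (eta_iso NN_11) e0.
rewrite -[_ p]/(etaR p); elim/V_ind: p => a etaRa.
apply: sum_e0_neq0; rewrite -etaRa eta_h.
(* Taking the matrix [s(a)] itself, not just an equivalent idempotent, makes [h(a)] and [h(s(a))]
   equal as matrices, by [hs]. *)
rewrite (@V_map_orthogonal_eq0 _ _ h a (map_idem s a)) ?raddf0 //.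
- exact: (full_prop (Gamma NN_11)).
- apply: (orthogonal_inj etaR_inj).
  by rewrite -V_map_class -eta_s etaRa; apply: e0_swap_orthogonal.
- by apply/infmxP => i j /=; rewrite -{1}hs.
Qed.
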